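(* Let $v\in\mathbb{R}^n$, $u\in C$, $\gamma\ge0$ and $\zeta\in(0,1]$. If $0\le\gamma<1/2$ and $\zeta=1-2\gamma$, then $$\mathcal{R}_{C,\gamma}^D(u,v)\subset\mathcal{P}_{C,\zeta}^D(u,v).$$
   Context: $C\subseteq\mathbb{R}^n$ is a nonempty closed convex set and $\langle\cdot,\cdot\rangle$ is the Euclidean inner product. For a fixed $\mu\ge1$, $\mathcal{D}_\mu$ is the set of symmetric positive definite $n\times n$ matrices with all eigenvalues in $[1/\mu,\mu]$; $D\in\mathcal{D}_\mu$ is fixed, $\|d\|_D:=\sqrt{\langle Dd,d\rangle}$, and $\mathcal{P}_C^D(v):=\arg\min_{z\in C}\|z-v\|_D^2$. For $u\in C$, $v\in\mathbb{R}^n$, $\zeta\in(0,1]$ and $\gamma\ge0$, $$\mathcal{P}_{C,\zeta}^D(u,v):=\{w\in C:\ \|w-v\|_D^2\le\zeta\|\mathcal{P}_C^D(v)-v\|_D^2+(1-\zeta)\|u-v\|_D^2\},$$ $$\mathcal{R}_{C,\gamma}^D(u,v):=\{w\in C:\ \langle D(v-w),y-w\rangle\le\gamma\|w-u\|_D^2\ \ \forall y\in C\}.$$ *)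

(* Defs.v *)
From mathcomp Require Import all_boot all_order all_algebra.
From mathcomp Require Import all_classical all_reals all_analysis.
Import Order.TTheory GRing.Theory Num.Theory.
Import numFieldNormedType.Exports.

Set Implicit Arguments.
Unset Strict Implicit.
Unset Printing Implicit Defensive.

Local Open Scope classical_set_scope.
Local Open Scope ring_scope.

Definition dot (R : realType) (n : nat) (x y : 'cV[R]_n) : R :=
  \sum_(i < n) x i 0 * y i 0.

Definition pos_def (R : realType) (n : nat) (D : 'M[R]_n) : Prop :=
  forall d : 'cV[R]_n, d != 0 -> 0 < dot (D *m d) d.

(* [eigenvalue] ranges over the eigenvalues in R, which for a real symmetric
   matrix are all of them. *)
Definition Dmu (R : realType) (n : nat) (mu : R) : set 'M[R]_n :=
  [set D | [/\ D \is symmetricmx, pos_def D &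
               forall a, eigenvalue D a -> 1 / mu <= a <= mu]].

Definition normD (R : realType) (n : nat) (D : 'M[R]_n) (d : 'cV[R]_n) : R :=
  Num.sqrt (dot (D *m d) d).

Definition argmin (R : realType) (T : Type) (C : set T) (f : T -> R) : set T :=
  [set z | C z /\ forall y, C y -> f z <= f y].

(* [get] picks an element of the argmin set, which is a singleton when C is
   nonempty, closed and convex and D is symmetric positive definite; on an
   empty argmin set it returns a default point unrelated to C. *)
Definition projD (R : realType) (n : nat) (C : set 'cV[R]_n) (D : 'M[R]_n)
    (v : 'cV[R]_n) : 'cV[R]_n :=
  get (argmin C (fun z => normD D (z - v) ^+ 2)).

Definition inexact_projP (R : realType) (n : nat) (C : set 'cV[R]_n)
    (D : 'M[R]_n) (zeta : R) (u v : 'cV[R]_n) : set 'cV[R]_n :=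
  [set w | C w /\
    normD D (w - v) ^+ 2 <=
      zeta * normD D (projD C D v - v) ^+ 2 + (1 - zeta) * normD D (u - v) ^+ 2].

Definition inexact_projR (R : realType) (n : nat) (C : set 'cV[R]_n)
    (D : 'M[R]_n) (gamma : R) (u v : 'cV[R]_n) : set 'cV[R]_n :=
  [set w | C w /\
    forall y, C y -> dot (D *m (v - w)) (y - w) <= gamma * normD D (w - u) ^+ 2].

(* Main.v *)
Require Import Defs.
From mathcomp Require Import all_boot all_order all_algebra.
From mathcomp Require Import all_classical all_reals all_analysis.
From mathcomp Require Import ring lra.
Import Order.TTheory GRing.Theory Num.Theory.
Import numFieldNormedType.Exports.
Local Open Scope classical_set_scope.
Local Open Scope ring_scope.

(** Write Q(d) = <Dd, d> and p for the projection of v onto C. Expanding the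
    square, Q(y - v) = Q(y - w) - 2 <D(v - w), y - w> + Q(w - v), so that
    w in R_{C,gamma}(u,v) gives, for every y in C,
      Q(w - v) <= Q(y - v) - Q(y - w) + 2 gamma Q(w - u).
    Adding zeta times the case y = p to 1 - zeta = 2 gamma times the case y = u,
    the terms in Q(w - u) cancel and -zeta Q(p - w) <= 0 is dropped. This needs
    p to lie in C, i.e. that the minimum defining p is attained: by the
    Cauchy-Schwarz inequality for D, each coordinate satisfies
    x_i^2 <= Q(D^-1 e_i) Q(x), so the sublevel sets of Q are compact. *)

Section dot_product.
Context {R : realType} {n : nat}.
Implicit Types x y z : 'cV[R]_n.

Lemma dotC x y : dot x y = dot y x.
Proof. by apply: eq_bigr => i _; rewrite mulrC. Qed.

Lemma dotDl x y z : dot (x + y) z = dot x z + dot y z.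
Proof. by rewrite -big_split; apply: eq_bigr => i _; rewrite mxE mulrDl. Qed.

Lemma dotZl a x z : dot (a *: x) z = a * dot x z.
Proof. by rewrite mulr_sumr; apply: eq_bigr => i _; rewrite mxE mulrA. Qed.

Lemma dotDr x y z : dot z (x + y) = dot z x + dot z y.
Proof. by rewrite dotC dotDl !(dotC z). Qed.

Lemma dotZr a x z : dot z (a *: x) = a * dot z x.
Proof. by rewrite dotC dotZl dotC. Qed.

Lemma dotNl x z : dot (- x) z = - dot x z.
Proof. by rewrite -scaleN1r dotZl mulN1r. Qed.

Lemma dotNr x z : dot z (- x) = - dot z x.
Proof. by rewrite dotC dotNl dotC. Qed.

Lemma dot0r x : dot x 0 = 0.
Proof. by rewrite -[0](scale0r 0) dotZr mul0r. Qed.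

Lemma dot_delta i x : dot (delta_mx i 0) x = x i 0.
Proof.
rewrite /dot (bigD1 i)//= big1 => [|j ji]; rewrite mxE ?eqxx ?mul1r ?addr0//.
by rewrite (negbTE ji) mul0r.
Qed.

Lemma dot_mulmx (D : 'M[R]_n) x y : dot (D *m x) y = dot x (D^T *m y).
Proof.
rewrite /dot; under eq_bigr => i _ do rewrite mxE mulr_suml.
rewrite exchange_big; apply: eq_bigr => j _ /=.
rewrite mxE mulr_sumr; apply: eq_bigr => i _.
by rewrite mxE mulrCA mulrA mulrC mulrA.
Qed.

End dot_product.

Section quadratic_form.
Context {R : realType} {n : nat} {D : 'M[R]_n}.
Hypotheses (symD : D^T = D) (posD : pos_def D).
Implicit Types x y v : 'cV[R]_n.

Let Q x := dot (D *m x) x.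

Lemma dot_mulmxC x y : dot (D *m x) y = dot (D *m y) x.
Proof. by rewrite dot_mulmx symD dotC. Qed.

Lemma quad_ge0 x : 0 <= Q x.
Proof.
have [->|/posD/ltW//] := eqVneq x 0.
by rewrite /Q dot0r.
Qed.

Lemma normD_sqr x : normD D x ^+ 2 = Q x.
Proof. by rewrite sqr_sqrtr// quad_ge0. Qed.

Lemma quadD x y : Q (x + y) = Q x + 2 * dot (D *m x) y + Q y.
Proof.
rewrite /Q mulmxDr dotDl !dotDr (dot_mulmxC y x); ring.
Qed.

Lemma quadN x : Q (- x) = Q x.
Proof. by rewrite /Q mulmxN dotNl dotNr opprK. Qed.

Lemma quadZ a x : Q (a *: x) = a ^+ 2 * Q x.
Proof. by rewrite /Q -scalemxAr dotZl dotZr mulrA. Qed.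

(** [Q] is nonnegative at [Q y *: x - dot (D *m x) y *: y], where it equals [Q y] times the
    difference of the two sides. For nonzero [y] the factor [Q y] is positive and can be
    cancelled. *)
Lemma quad_cauchy_schwarz x y : dot (D *m x) y ^+ 2 <= Q x * Q y.
Proof.
have [->|/posD y0] := eqVneq y 0; first by rewrite /Q !dot0r mulr0 expr0n.
have := quad_ge0 (Q y *: x + (- dot (D *m x) y) *: y).
rewrite quadD !quadZ -scalemxAr dotZl dotZr.
rewrite (_ : _ + _ = Q y * (Q x * Q y - dot (D *m x) y ^+ 2)).
  by rewrite pmulr_rge0// subr_ge0.
ring.
Qed.

(** If [x *m D = 0] for a row [x], then [D *m x^T = 0] by symmetry, so [Q] vanishes at [x^T], which
    forces [x = 0]. *)
Lemma pos_def_unitmx : D \in unitmx.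
Proof.
rewrite -row_free_unit; apply: inj_row_free => x xD0.
apply: trmx_inj; rewrite trmx0; apply/eqP/negPn/negP => /posD.
by rewrite -symD -trmx_mul xD0 trmx0 dotC dot0r ltxx.
Qed.

Lemma coord_sqr_le_quad i x :
  x i 0 ^+ 2 <= Q (invmx D *m delta_mx i 0) * Q x.
Proof.
have := quad_cauchy_schwarz (invmx D *m delta_mx i 0) x.
by rewrite mulKVmx ?pos_def_unitmx// dot_delta.
Qed.

End quadratic_form.

Lemma continuous_quad {R : realType} {n : nat} (D : 'M[R]_n) (v : 'cV[R]_n) :
  continuous (fun z : 'cV[R]_n => dot (D *m (z - v)) (z - v)).
Proof.
have coordB i : continuous (fun z : 'cV[R]_n => (z - v) i 0).
  under eq_fun do rewrite !mxE.
  by move=> z; apply: (@cvgB _ _ _ (nbhs z)); [exact: coord_continuous|exact: cvg_cst].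
have mulD i : continuous (fun z : 'cV[R]_n => (D *m (z - v)) i 0).
  under eq_fun do rewrite mxE.
  apply: (@continuous_big _ _ +%R 0 xpredT add_continuous) => j _ z.
  by apply: (@cvgM _ _ (nbhs z)); [exact: cvg_cst|exact: coordB].
apply: (@continuous_big _ _ +%R 0 xpredT add_continuous) => i _ z.
by apply: (@cvgM _ _ (nbhs z)); [exact: mulD|exact: coordB].
Qed.

(** The box is the image under transposition of a box of row vectors, which is compact as a product
    of segments. *)
Lemma cV_box_compact {R : realType} {n : nat} (a b : 'I_n -> R) :
  compact [set z : 'cV[R]_n | forall i, z i 0 \in `[a i, b i]].
Proof.
set B := (X in compact X).
pose A := [set z : 'rV[R]_n | forall i, `[a i, b i]%classic (z ord0 i)].
suff -> : B = trmx @` A.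
  have trmx_cont : continuous (@trmx R 1 n).
    (* A neighbourhood of a matrix contains a product of neighbourhoods [P i j] of its entries;
       swapping the indices of [P] gives one for the preimage. *)
    move=> z S [P Pz PS].
    exists (fun i j => P j i) => [i j|y Py] /=.
      by have := Pz j i; rewrite mxE.
    by apply: PS => i j; rewrite mxE.
  have Aco : compact A.
    apply: (@rV_compact _ _ (fun i => `[a i, b i]%classic)) => i.
    exact: segment_compact.
  exact (continuous_compact (continuous_subspaceT trmx_cont) Aco).
apply/seteqP; split => [z Bz|_ [z Az <-] i]; last by rewrite mxE; exact: Az.
by exists z^T; [move=> i; rewrite mxE; exact: Bz|rewrite trmxK].
Qed.

Lemma argmin_quad_nonempty {R : realType} {n : nat} {D : 'M[R]_n}
    {C : set 'cV[R]_n} (v : 'cV[R]_n) :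
  D^T = D -> pos_def D -> C !=set0 -> closed C ->
  argmin C (fun z => dot (D *m (z - v)) (z - v)) !=set0.
Proof.
move=> symD posD [u Cu] Ccl.
set f := fun z => _; pose A := C `&` [set z | f z <= f u].
have f_cont : continuous f := continuous_quad D v.
have Acl : closed A.
  apply: closedI => //; apply: (preimage_closed (D := [set x | x <= f u])).
    by move=> z _; exact: f_cont.
  exact: closed_le.
(* Half-widths of a box around [v] containing [A]: the coordinate bound at [z - v], together with
   [f z <= f u], gives [(z i 0 - v i 0) ^+ 2 <= m i ^+ 2]. *)
pose m i := Num.sqrt (dot (D *m (invmx D *m delta_mx i 0))
                          (invmx D *m delta_mx i 0) * f u).
have Aco : compact A.
  apply: subclosed_compact Acl
    (cV_box_compact (fun i => v i 0 - m i) (fun i => v i 0 + m i)) _.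
  move=> z [_ /= fz] i; rewrite in_itv /= -ler_distl.
  rewrite -sqrtr_sqr ler_sqrt ?mulr_ge0 ?quad_ge0//.
  have := coord_sqr_le_quad symD posD i (z - v); rewrite !mxE => /le_trans; apply.
  by rewrite ler_wpM2l ?quad_ge0.
have A0 : A !=set0 by exists u; split => //=.
have [c /set_mem[Cc fc] cmin] :=
  compact_EVT_min A0 Aco (continuous_subspaceT f_cont).
(* The minimizer over [A] is one over [C]: a point of [C] outside [A] has value above [f u], hence
   above [f c]. *)
exists c; split => // y Cy; have [fy|/ltW fy] := leP (f y) (f u).
  by apply: cmin; exact/mem_set.
exact: le_trans fc fy.
Qed.

(** Once the argmin set is known to be nonempty, [get] returns one of its elements rather than the
    default point. *)
Lemma projD_in {R : realType} {n : nat} {D : 'M[R]_n} {C : set 'cV[R]_n}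
    (v : 'cV[R]_n) :
  D^T = D -> pos_def D -> C !=set0 -> closed C -> C (projD C D v).
Proof.
move=> symD posD C0 Ccl.
have [z zmin] := argmin_quad_nonempty v symD posD C0 Ccl.
rewrite /projD (_ : (fun z => _) = (fun z => dot (D *m (z - v)) (z - v))).
  by have [] : argmin C _ (get _) := getPex (ex_intro _ z zmin).
by apply/funext => y; rewrite normD_sqr.
Qed.

Theorem lemma6 (R : realType) (n : nat) (C : set 'cV[R]_n)
    (C_nonempty : C !=set0) (C_closed : closed C) (C_convex : convex_set C)
    (mu : R) (mu_ge1 : 1 <= mu) (D : 'M[R]_n) (D_Dmu : Dmu mu D)
    (v u : 'cV[R]_n) (u_C : C u) (gamma zeta : R)
    (gamma_ge0 : 0 <= gamma) (zeta_gt0 : 0 < zeta) (zeta_le1 : zeta <= 1)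
    (gamma_lt : 0 <= gamma < 1 / 2) (zeta_eq : zeta = 1 - 2 * gamma) :
  inexact_projR C D gamma u v `<=` inexact_projP C D zeta u v.
Proof.
have [/is_hermitianmxP symD' posD _] := D_Dmu.
(* [symmetricmx] is the Hermitian condition with sign [(-1) ^+ 0] and the identity as conjugation;
   both are simplified away. *)
have symD : D^T = D by rewrite [RHS]symD' expr0 scale1r map_mx_id.
move=> w [Cw wR]; split => //.
have three_points y : C y -> normD D (w - v) ^+ 2 <=
    normD D (y - v) ^+ 2 - normD D (y - w) ^+ 2 + 2 * gamma * normD D (w - u) ^+ 2.
  move=> Cy; have := wR y Cy; rewrite !(normD_sqr posD).
  (* Expansion of [Q] at [y - v = (w - v) + (y - w)]; the cross term is, up to sign, the inner
     product bounded in [wR]. *)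
  rewrite -[y - v](subrKA w) [y - w + _]addrC (quadD symD (w - v) (y - w)).
  rewrite -(opprB w v) mulmxN dotNl.
  lra.
have := three_points _ u_C.
have := three_points _ (projD_in v symD posD C_nonempty C_closed).
have -> : normD D (u - w) ^+ 2 = normD D (w - u) ^+ 2.
  by rewrite !(normD_sqr posD) -opprB quadN.
have := sqr_ge0 (normD D (projD C D v - w)); subst zeta.
move: (normD D (projD C D v - w) ^+ 2) (normD D (w - u) ^+ 2) => a b.
(* The weights are [1 - 2 * gamma] on the projection case and on [0 <= a], and [2 * gamma] on the
   case of [u]; the terms in [b] cancel. *)
nra.
Qed.
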